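(* Let $\mathbb{F}$ be a field and let $f_1=0,\dots,f_m=0$ be a system of linear equations over $\mathbb{F}$ in $n$ variables with no 0-1 solution. Let $A:\overline{x}\mapsto(f_1(\overline{x}),\dots,f_m(\overline{x}))$. Then there is a $\mathrm{Res}(\mathrm{lin}_{\mathbb{F}})$ derivation (from the boolean axioms alone) of the linear clause $\langle A\overline{x}\ne 0\rangle:=\langle f_1\ne 0\rangle\vee\dots\vee\langle f_m\ne 0\rangle$ of size polynomial in $n+|im_2(A\overline{x})|$.
   Context: $im_2(g)$ denotes the image of a (vector of) linear form(s) $g$ under all 0-1 assignments; $\langle f\ne a\rangle:=\bigvee_{b\in im_2(f),\,b\ne a}(f=b)$. A linear clause over $\mathbb{F}$ is a disjunction of linear equations (duplicates identified); variables range over $\{0,1\}$. $\mathrm{Res}(\mathrm{lin}_{\mathbb{F}})$: boolean axioms $x=0\vee x=1$; rules resolution (from $C\vee f=0$ and $D\vee g=0$ derive $C\vee D\vee(\alpha f+\beta g=0)$, $\alpha,\beta\in\mathbb{F}$), simplification (from $C\vee a=0$, $a\in\mathbb{F}\setminus\{0\}$, derive $C$), weakening (from $C$ derive $C\vee f=0$). A derivation is a sequence of linear clauses each a boolean axiom or obtained from earlier ones by a rule; size is total number of variable occurrences plus total size of coefficients.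
   Formalization: Over an infinite field the stated bound fails (e.g. i·x+i=0 for i≤m over Q), so there the size is polynomial in n+|im_2(A)| plus the sizes of the system and of the derived clause; the literal bound is proved for finite fields; n≥1 is assumed. *)

(* Defs.v *)
From mathcomp Require Import all_boot all_order all_algebra.
From mathcomp Require Import finmap.

Set Implicit Arguments.
Unset Strict Implicit.
Unset Printing Implicit Defensive.

Import GRing.Theory.
Local Open Scope ring_scope.
Local Open Scope fset_scope.

(* (a, c) is the form \sum_i a_i x_i + c, and it also stands for the linear
   equation \sum_i a_i x_i + c = 0. F^o is F as a module over itself, which
   gives forms their module structure. *)
Notation linform F n := ('rV[F]_n * F^o)%type.

Definition varform (F : fieldType) (n : nat) (i : 'I_n) : linform F n :=
  (delta_mx 0 i, 0).

Definition cstform (F : fieldType) (n : nat) (c : F) : linform F n := (0, c).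

Definition lineval (F : fieldType) (n : nat) (f : linform F n)
    (x : {ffun 'I_n -> bool}) : F :=
  (\sum_(i < n) f.1 0 i * (x i)%:R) + f.2.

Definition im2 (F : fieldType) (n : nat) (f : linform F n) : {fset F} :=
  [fset lineval f x | x : {ffun 'I_n -> bool}].

Definition im2_vec (F : fieldType) (n m : nat) (f : 'I_m -> linform F n) :
    {fset 'rV[F]_m} :=
  [fset \row_(i < m) lineval (f i) x | x : {ffun 'I_n -> bool}].

(* A linear clause is the set of its disjuncts. *)
Notation clause F n := {fset linform F n}.

(* The equation f = b is the form f - b. *)
Definition neq_clause (F : fieldType) (n : nat) (f : linform F n) (a : F) :
    clause F n :=
  [fset f - cstform n b | b in im2 f & b != a].

Definition neq0_clause (F : fieldType) (n m : nat) (f : 'I_m -> linform F n) :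
    clause F n :=
  \big[fsetU/fset0]_(i < m) neq_clause (f i) 0.

Inductive reslin_step (F : fieldType) (n : nat) (prev : seq (clause F n)) :
    clause F n -> Prop :=
| BooleanAxiom (i : 'I_n) :
    reslin_step prev [fset varform F i; varform F i - cstform n 1]
| Resolution (C D : clause F n) (f g : linform F n) (alpha beta : F) :
    f |` C \in prev -> g |` D \in prev ->
    reslin_step prev ((alpha *: f + beta *: g)%R |` (C `|` D))
| Simplification (C : clause F n) (a : F) :
    a != 0 -> cstform n a |` C \in prev -> reslin_step prev C
| Weakening (C : clause F n) (f : linform F n) :
    C \in prev -> reslin_step prev (f |` C).

Inductive reslin_seq (F : fieldType) (n : nat) : seq (clause F n) -> Prop :=
| ReslinNil : reslin_seq [::]
| ReslinRcons (pi : seq (clause F n)) (C : clause F n) :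
    reslin_seq pi -> reslin_step pi C -> reslin_seq (rcons pi C).

Definition reslin_derivation (F : fieldType) (n : nat)
    (pi : seq (clause F n)) (C : clause F n) : Prop :=
  reslin_seq pi /\ exists pi', pi = rcons pi' C.

(* csize is the size of the encoding of a field element. Only variables with a
   nonzero coefficient occur in a form. *)
Definition linform_size (F : fieldType) (csize : F -> nat) (n : nat)
    (f : linform F n) : nat :=
  (\sum_(i < n | f.1 0%R i != 0%R) (1 + csize (f.1 0%R i)) + csize f.2)%N.

Definition system_size (F : fieldType) (csize : F -> nat) (n m : nat)
    (f : 'I_m -> linform F n) : nat :=
  (\sum_(i < m) linform_size csize (f i))%N.

Definition clause_size (F : fieldType) (csize : F -> nat) (n : nat)
    (C : clause F n) : nat :=
  (\sum_(f <- C) linform_size csize f)%N.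

Definition derivation_size (F : fieldType) (csize : F -> nat) (n : nat)
    (pi : seq (clause F n)) : nat :=
  (\sum_(C <- pi) clause_size csize C)%N.

Definition no01_solution (F : fieldType) (n m : nat)
    (f : 'I_m -> linform F n) : Prop :=
  ~ exists x : {ffun 'I_n -> bool}, forall i : 'I_m, lineval (f i) x = 0.

(* Main.v *)
Require Import Defs.
From mathcomp Require Import all_boot all_order all_algebra.
From mathcomp Require Import finmap.
From mathcomp Require Import zify.

(* Write P_k f for the form f with the variables of index >= k deleted. The
   clauses \/_b (P_k f_i = b), b in im2 (P_k f_i), are derived for increasing k
   by resolving with boolean axioms. For v in im2 (P_k A), let N_{k,v} be the
   clause <P_k A <> v> \/ <A <> 0>. N_{n,v} weakens some \/_b (f_i = b), since
   v <> 0, and N_{k,v} follows from the clauses N_{k+1,w}, where w runs over the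
   two values to which the variable x_k can extend v; N_{0,v} is <A <> 0>.
   The number m of equations must not enter the bound: choosing one violated
   equation per value of A gives an unsatisfiable subsystem of |im2 A| equations,
   whose clause weakens to <A <> 0>. Over a finite field of q elements the goal
   clause itself is short because, for A of rank r, it has at most q^(r+1)
   disjuncts while im2 A has at least 2^r elements. *)

Set Implicit Arguments.
Unset Strict Implicit.
Unset Printing Implicit Defensive.

(** * Counting proof lines inside a fixed set of forms *)

Section Derives.

Import GRing.Theory.
Local Open Scope fset_scope.
Local Open Scope ring_scope.

Variables (F : fieldType) (n : nat).
Implicit Types (C D R U : clause F n) (H Cs pi : seq (clause F n)).

Lemma reslin_step_subset pi pi' C :
  {subset pi <= pi'} -> reslin_step pi C -> reslin_step pi' C.
Proof.
move=> sub [i|A B f g a b /sub fA /sub gB|A a a0 /sub aA|A f /sub sA].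
- exact: BooleanAxiom.
- exact: Resolution fA gB.
- exact: Simplification a0 aA.
- exact: Weakening.
Qed.

(** A derivation has to end in its target clause, while [derives] only makes the target occur;
    cutting the sequence after an occurrence bridges the two. *)
Lemma reslin_seq_prefix pi C : reslin_seq pi -> C \in pi ->
  exists pi', [/\ reslin_seq (rcons pi' C), {subset rcons pi' C <= pi} &
    (size (rcons pi' C) <= size pi)%N].
Proof.
elim=> [//|{}pi D pi_ok IH stD]; rewrite mem_rcons inE => /orP[/eqP->|/IH].
  by exists pi; split => //; exact: ReslinRcons.
case=> pi' [ok sub le]; exists pi'; split => //; last first.
  by apply: leq_trans le _; rewrite size_rcons.
by move=> X /sub; rewrite mem_rcons inE => ->; rewrite orbT.
Qed.

(* Restricting all lines to subclauses of one finite set U of forms bounds the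
   size of a derivation by its number of lines times the size of U. *)
Definition derives U (t : nat) H Cs : Prop :=
  forall pi, reslin_seq pi -> {subset H <= pi} ->
  exists2 pi', reslin_seq (pi ++ pi') &
    [/\ (size pi' <= t)%N, all (fun C => C `<=` U) pi' &
        {subset Cs <= pi ++ pi'}].

Lemma derives_sub U t H Cs t' H' Cs' :
    (t <= t')%N -> {subset H <= H'} -> {subset Cs' <= Cs} ->
  derives U t H Cs -> derives U t' H' Cs'.
Proof.
move=> tt sH sC dC pi pi_ok sub.
have [|pi' ok [st aU sC']] := dC pi pi_ok; first by move=> X /sH /sub.
exists pi' => //; split=> //; first exact: leq_trans tt.
by move=> X /sC /sC'.
Qed.

Lemma derives_leq U t t' H Cs : (t <= t')%N -> derives U t H Cs -> derives U t' H Cs.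
Proof. by move=> tt; apply: derives_sub. Qed.

Lemma derives_hyp U t H Cs : {subset Cs <= H} -> derives U t H Cs.
Proof.
move=> sC pi pi_ok sub; exists [::]; rewrite ?cats0 //.
by split=> // X /sC /sub.
Qed.

Lemma derives_cut U t1 t2 H Cs1 Cs2 :
  derives U t1 H Cs1 -> derives U t2 (Cs1 ++ H) Cs2 ->
  derives U (t1 + t2) H (Cs1 ++ Cs2).
Proof.
move=> d1 d2 pi pi_ok sub.
have [pi1 ok1 [s1 a1 c1]] := d1 pi pi_ok sub.
have [|pi2 ok2 [s2 a2 c2]] := d2 _ ok1.
  by move=> X; rewrite mem_cat => /orP[/c1|/sub] //; rewrite mem_cat => ->.
exists (pi1 ++ pi2); rewrite ?catA //; split.
- by rewrite size_cat leq_add.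
- by rewrite all_cat a1.
- by move=> X; rewrite mem_cat => /orP[/c1|/c2] //; rewrite !mem_cat => ->.
Qed.

Lemma derives_trans U t1 t2 H Cs1 Cs2 :
  derives U t1 H Cs1 -> derives U t2 (Cs1 ++ H) Cs2 -> derives U (t1 + t2) H Cs2.
Proof.
move=> d1 d2; apply: derives_sub (derives_cut d1 d2) => //.
by move=> X; rewrite mem_cat orbC => ->.
Qed.

Lemma derives_all U t H Cs :
  (forall C, C \in Cs -> derives U t H [:: C]) -> derives U (size Cs * t) H Cs.
Proof.
elim: Cs => [|C Cs IH] dC; first exact: derives_hyp.
rewrite /= mulSn -cat1s; apply: derives_cut.
  by apply: dC; rewrite mem_head.
apply: derives_sub (IH _) => //.
  by move=> X; rewrite mem_cat orbC => ->.
by move=> X XC; apply: dC; rewrite inE XC orbT.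
Qed.

Lemma derives_step U H C : C `<=` U -> reslin_step H C -> derives U 1 H [:: C].
Proof.
move=> sCU st pi pi_ok sub; exists [:: C].
  by rewrite cats1; apply: ReslinRcons => //; apply: reslin_step_subset st.
split=> //=; first by rewrite sCU.
by move=> X; rewrite inE => /eqP->; rewrite mem_cat mem_head orbT.
Qed.

Lemma derives_res U H A D f g (a b : F) C :
    f |` A \in H -> g |` D \in H -> C = (a *: f + b *: g)%R |` (A `|` D) ->
    C `<=` U ->
  derives U 1 H [:: C].
Proof.
by move=> fA gD -> sU; apply: derives_step => //; apply: Resolution.
Qed.

(** One weakening per disjunct of [D]. The intermediate clauses lie between [C] and [D], so they
    stay within [U]. *)
Lemma derives_weak U H C D : C \in H -> C `<=` D -> D `<=` U ->
  derives U #|` U| H [:: D].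
Proof.
move=> CH sCD sDU.
suff W (E : clause F n) : E `<=` D -> derives U #|` E| H [:: E `|` C].
  rewrite -(fsetUidPl _ _ sCD).
  by apply: derives_leq (W D (fsubset_refl D)); apply: fsubset_leq_card.
elim/fset1U_rect: E => [|f E fE IH] sED.
  by rewrite fset0U; apply: derives_hyp => X; rewrite inE => /eqP->.
move: sED; rewrite fsubUset fsub1set => /andP[fD sED].
rewrite cardfsU1 fE addnC -fsetUA; apply: derives_trans (IH sED) _.
apply: derives_step; last by apply: Weakening; rewrite mem_head.
by apply: fsubset_trans sDU; rewrite !fsubUset fsub1set fD sED.
Qed.

(** The disjuncts of [E] are removed one at a time. Those not yet removed are still present, so each
    removal has to work in an arbitrary context [C] between [D] and [U]. *)
Lemma derives_elim U t H (E D : clause F n) :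
    E `|` D `<=` U -> E `|` D \in H ->
    (forall e C, e \in E -> D `<=` C -> C `<=` U ->
       derives U t (e |` C :: H) [:: C]) ->
  derives U (#|` U| * t) H [:: D].
Proof.
move=> sEDU EDH elimE.
suff W (A : clause F n) : A `<=` E ->
    derives U (#|` A| * t) (A `|` D :: H) [:: D].
  apply: derives_sub (W E (fsubset_refl E)) => //.
    rewrite leq_mul2r fsubset_leq_card ?orbT //.
    by apply: fsubset_trans sEDU; apply: fsubsetUl.
  by move=> X; rewrite inE => /orP[/eqP->|].
elim/fset1U_rect: A => [|f A fA IH] sAE.
  by rewrite fset0U; apply: derives_hyp => X; rewrite inE => /eqP->; rewrite mem_head.
move: sAE; rewrite fsubUset fsub1set => /andP[fE sAE].
rewrite cardfsU1 fA mulSn -fsetUA; apply: derives_trans.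
  apply: elimE fE (fsubsetUr _ _) _.
  by apply: fsubset_trans sEDU; apply: fsetSU.
apply: derives_sub (IH sAE) => // X.
by rewrite !inE => /orP[->//|->]; rewrite !orbT.
Qed.

Lemma clause_size_sub (csize : F -> nat) C D :
  C `<=` D -> (clause_size csize C <= clause_size csize D)%N.
Proof.
move=> sCD; rewrite /clause_size [X in (_ <= X)%N](big_fsetID _ (mem C)) /=.
apply: leq_trans (leq_addr _ _).
rewrite (_ : [fset x | x in D & x \in C] = C) //.
by apply/fsetP=> x; rewrite !inE /=; apply/andP/idP => [[]//|xC]; split=> //; apply: (fsubsetP sCD).
Qed.

Lemma derives_derivation (csize : F -> nat) U t C : derives U t [::] [:: C] ->
  exists pi, reslin_derivation pi C /\
    (derivation_size csize pi <= t * clause_size csize U)%N.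
Proof.
move=> /(_ [::] (ReslinNil _ _)) [//|pi ok [st aU sC]].
have [|pi' [ok' sub le]] := @reslin_seq_prefix pi C ok.
  by apply: sC; rewrite mem_head.
exists (rcons pi' C); split; first by split => //; exists pi'.
apply: (@leq_trans (size (rcons pi' C) * clause_size csize U)).
  rewrite /derivation_size -sum1_size big_distrl /= !big_seq.
  apply: leq_sum => D /sub /(allP aU) ?; rewrite mul1n; exact: clause_size_sub.
by rewrite leq_mul2r (leq_trans le st) orbT.
Qed.

End Derives.

(** * Prefixes of linear forms and their values *)

Section Forms.

Import GRing.Theory.
Local Open Scope fset_scope.
Local Open Scope ring_scope.

Variables (F : fieldType) (n : nat).
Implicit Types (f g : linform F n) (x : {ffun 'I_n -> bool}) (k : nat).

Lemma linformP f g : f.1 = g.1 -> f.2 = g.2 -> f = g.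
Proof. by case: f g => [? ?] [? ?] /= -> ->. Qed.

Lemma im2P f (b : F) : reflect (exists x, b = lineval f x) (b \in im2 f).
Proof.
apply: (iffP (imfsetP _ _ _ _)) => [[x _ ->]|[x ->]]; first by exists x.
by exists x.
Qed.

Lemma im2_vecP m (f : 'I_m -> linform F n) (v : 'rV[F]_m) :
  reflect (exists x, v = \row_(i < m) lineval (f i) x) (v \in im2_vec f).
Proof.
apply: (iffP (imfsetP _ _ _ _)) => [[x _ ->]|[x ->]]; first by exists x.
by exists x.
Qed.

Lemma neq_clauseP f (a : F) (h : linform F n) :
  reflect (exists b, [/\ b \in im2 f, b != a & h = f - cstform n b])
    (h \in neq_clause f a).
Proof.
apply: (iffP (imfsetP _ _ _ _)) => [[b /andP[bf ba] ->]|[b [bf ba ->]]].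
  by exists b.
by exists b => //; apply/andP.
Qed.

Lemma neq0_clauseP m (f : 'I_m -> linform F n) (h : linform F n) :
  reflect (exists i, h \in neq_clause (f i) 0) (h \in neq0_clause f).
Proof.
apply: (iffP (bigfcupP _ _ _ _)) => [[i _ hi]|[i hi]]; first by exists i.
by exists i => //; rewrite mem_index_enum.
Qed.

Definition linform_prefix k f : linform F n :=
  (\row_(j < n) if (j < k)%N then f.1 0 j else 0, f.2).

Definition im2_clause f : clause F n := [fset f - cstform n b | b in im2 f].

Lemma im2_clauseP f (h : linform F n) :
  reflect (exists2 b, b \in im2 f & h = f - cstform n b) (h \in im2_clause f).
Proof. exact: imfsetP. Qed.

Definition set_bit x (j : 'I_n) (e : bool) : {ffun 'I_n -> bool} :=
  [ffun i : 'I_n => if i == j then e else x i].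

Definition bit_prefix k x : {ffun 'I_n -> bool} := [ffun j : 'I_n => (j < k)%N && x j].

Lemma linform_prefix_full f : linform_prefix n f = f.
Proof. by apply: linformP => //=; apply/rowP=> j; rewrite mxE ltn_ord. Qed.

Lemma linform_prefix0 f : linform_prefix 0 f = cstform n f.2.
Proof. by apply: linformP => //=; apply/rowP=> j; rewrite !mxE. Qed.

Lemma linform_prefixS f (j : 'I_n) :
  linform_prefix j.+1 f = linform_prefix j f + f.1 0 j *: varform F j.
Proof.
apply: linformP => /=; last by rewrite [f.1 0 j *: _]mulr0 addr0.
apply/rowP=> i; rewrite !mxE eqxx /= ltnS leq_eqVlt -val_eqE /=.
case: ltngtP => ij; rewrite ?mulr0 ?addr0 ?add0r ?mulr1 //.
by rewrite (val_inj ij).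
Qed.

(** Deleting variables amounts to setting them to 0. Hence the values occurring at any level are
    values of the given forms. *)
Lemma lineval_prefix k f x : lineval (linform_prefix k f) x = lineval f (bit_prefix k x).
Proof.
rewrite /lineval /=; congr (_ + _); apply: eq_bigr => j _.
by rewrite !mxE ffunE; case: ltnP; rewrite ?mul0r ?mulr0.
Qed.

Lemma im2_prefix_sub k f : {subset im2 (linform_prefix k f) <= im2 f}.
Proof.
move=> b /im2P[x ->]; apply/im2P; exists (bit_prefix k x).
exact: lineval_prefix.
Qed.

Lemma lineval_prefixS f x (j : 'I_n) (e : bool) :
  lineval (linform_prefix j.+1 f) (set_bit x j e) =
  lineval (linform_prefix j f) x + f.1 0 j *+ e.
Proof.
rewrite !lineval_prefix /lineval addrAC; congr (_ + _).
rewrite (bigD1 j) //= [in RHS](bigD1 j) //= !ffunE ltnS leqnn ltnn eqxx /=.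
rewrite mulr0 add0r addrC mulr_natr; congr (_ + _).
apply: eq_bigr => i ij; rewrite !ffunE (negPf ij) ltnS leq_eqVlt.
by rewrite (_ : (i == j :> nat) = false) //; apply: negPf.
Qed.

Lemma im2_prefixS f (j : 'I_n) (e : bool) b :
  b \in im2 (linform_prefix j f) -> b + f.1 0 j *+ e \in im2 (linform_prefix j.+1 f).
Proof.
case/im2P=> x ->; apply/im2P; exists (set_bit x j e).
by rewrite lineval_prefixS.
Qed.

Lemma im2_prefix0 f b : (b \in im2 (linform_prefix 0 f)) = (b == f.2).
Proof.
have L x : lineval (linform_prefix 0 f) x = f.2.
  rewrite /lineval big1 ?add0r // => i _; by rewrite mxE mul0r.
apply/im2P/eqP => [[x ->]|->]; first exact: L.
by exists [ffun=> false]; rewrite L.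
Qed.

Definition literal (j : 'I_n) (e : bool) : linform F n :=
  varform F j - cstform n e%:R.

Lemma literal0 j : literal j false = varform F j.
Proof. by apply: linformP; rewrite /= subr0. Qed.

(** The literal x_j = e, scaled by the coefficient of x_j, supplies the next term of the form, and
    [b] moves to the value of the longer prefix. *)
Lemma resolve_literal f (j : 'I_n) e b :
  1 *: (linform_prefix j f - cstform n b) + f.1 0 j *: literal j e =
  linform_prefix j.+1 f - cstform n (b + f.1 0 j *+ e).
Proof.
rewrite linform_prefixS; apply: linformP => /=.
  by rewrite !subr0 scale1r.
rewrite [f.1 0 j *: 0]mulr0 addr0 sub0r [1 *: _]mul1r.
by rewrite [f.1 0 j *: _]mulrN opprD addrA mulr_natr.
Qed.

(* The scaling makes the resolvent 1, so that no constant c - b, whose encoding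
   may be long, occurs in the derivation. *)
Lemma resolve_values f (b c : F) : b != c ->
  (c - b)^-1 *: (f - cstform n b) + (- (c - b)^-1) *: (f - cstform n c) =
  cstform n 1.
Proof.
move=> bc; apply: linformP => /=; first by rewrite !subr0 scaleNr subrr.
rewrite [_^-1 *: _]mulrBr [- _ *: _]mulrBr !mulNr opprK addrACA subrr add0r addrC -mulrBr mulVf //.
by rewrite subr_eq0 eq_sym.
Qed.

End Forms.

(** * The derivation, level by level *)

Section Refutation.

Import GRing.Theory.
Local Open Scope fset_scope.
Local Open Scope ring_scope.

Variables (F : fieldType) (n m : nat) (g : 'I_m -> linform F n) (U : clause F n).

Local Notation P k i := (linform_prefix k (g i)).
Local Notation M := #|` U|.

(** [U] stays abstract; the four hypotheses name the forms that the construction writes down. The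
    case k = n covers the disjuncts of the goal. *)
Hypothesis prefixU : forall k i b, (k <= n)%N -> b \in im2 (g i) ->
  P k i - cstform n b \in U.
Hypothesis literalU : forall j e, literal F j e \in U.
Hypothesis oneU : cstform n 1 \in U.
Hypothesis zeroU : cstform n 0 \in U.

Implicit Types (k : nat) (v w : 'rV[F]_m) (h : linform F n).

Definition boolean_axiom (j : 'I_n) : clause F n :=
  [fset literal F j false; literal F j true].

Definition prefix_values k (i : 'I_m) : clause F n := im2_clause (P k i).

(* This clause excludes the solutions of the system whose restriction to the
   first k variables, extended by zeros, gives the forms the value v. *)
Definition prefix_neq k (v : 'rV[F]_m) : clause F n :=
  (\big[fsetU/fset0]_(i < m) neq_clause (P k i) (v 0 i)) `|` neq0_clause g.

Definition prefix_im2 k : {fset 'rV[F]_m} := im2_vec (fun i => P k i).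

Lemma prefix_valuesU k i : (k <= n)%N -> prefix_values k i `<=` U.
Proof.
move=> kn; apply/fsubsetP => h /im2_clauseP[b bP ->].
by apply: prefixU => //; apply: im2_prefix_sub bP.
Qed.

Lemma prefix_neqP k v h :
  reflect ((exists i b, [/\ b \in im2 (P k i), b != v 0 i & h = P k i - cstform n b])
           \/ h \in neq0_clause g)
    (h \in prefix_neq k v).
Proof.
rewrite inE; apply: (iffP orP) => -[] hN; [left| by right|left| by right].
  have /bigfcupP[i _ /neq_clauseP[b hb]] := hN; by exists i, b.
case: hN => i [b hb]; apply/bigfcupP; exists i; first by rewrite mem_index_enum.
by apply/neq_clauseP; exists b.
Qed.

Lemma neq0_clauseU : neq0_clause g `<=` U.
Proof.
apply/fsubsetP => h /neq0_clauseP[i /neq_clauseP[b [bi _ ->]]].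
by rewrite -[X in X - _](linform_prefix_full) prefixU.
Qed.

Lemma prefix_neqU k v : (k <= n)%N -> prefix_neq k v `<=` U.
Proof.
move=> kn; apply/fsubsetP => h /prefix_neqP[[i [b [bP _ ->]]]|].
  by apply: prefixU => //; apply: im2_prefix_sub bP.
exact/fsubsetP/neq0_clauseU.
Qed.

(** A prefix of length 0 is a constant whose only value is [v 0 i], so excluding that value leaves
    no disjunct. *)
Lemma prefix_neq0 v : v \in prefix_im2 0 -> prefix_neq 0 v = neq0_clause g.
Proof.
case/im2_vecP => x ->; apply/fsetP => h; apply/prefix_neqP/idP => [[[i [b []]]|//]|]; last by right.
rewrite im2_prefix0 => /eqP-> /negP[].
have : lineval (P 0 i) x \in im2 (P 0 i) by apply/im2P; exists x.
by rewrite im2_prefix0 mxE eq_sym.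
Qed.

Lemma boolean_axiomU j : boolean_axiom j `<=` U.
Proof. by rewrite fsubUset !fsub1set !literalU. Qed.

Lemma derives_boolean_axiom H j : derives U 1 H [:: boolean_axiom j].
Proof.
apply: derives_step; first exact: boolean_axiomU.
rewrite /boolean_axiom literal0; exact: BooleanAxiom.
Qed.

(** Resolution with both coefficients 0 replaces a disjunct by 0 = 0. Doing this to both literals of
    a boolean axiom leaves 0 = 0 alone, since equal disjuncts merge. *)
Lemma derives_zero H j : boolean_axiom j \in H ->
  derives U 2 H [:: [fset cstform n 0]].
Proof.
move=> jH.
have zE (f : linform F n) : 0 *: f + 0 *: f = cstform n 0.
  by apply: linformP; rewrite /= ?scale0r ?addr0.
have -> : 2%N = (1 + 1)%N by [].
apply: derives_trans.
  apply: (@derives_res _ _ U H [fset literal F j true] [fset literal F j true]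
    (literal F j false) (literal F j false) 0 0 (literal F j true |` [fset cstform n 0])) => //.
    by rewrite zE fsetUid fsetUC.
  by rewrite fsubUset !fsub1set literalU zeroU.
apply: (@derives_res _ _ U _ [fset cstform n 0] [fset cstform n 0]
    (literal F j true) (literal F j true) 0 0); rewrite ?mem_head //.
  by rewrite zE !fsetUid.
by rewrite fsub1set.
Qed.

Lemma prefix_values0 i : prefix_values 0 i = [fset cstform n 0].
Proof.
apply/fsetP=> h; rewrite in_fset1; apply/im2_clauseP/eqP.
  case=> b; rewrite im2_prefix0 => /eqP-> ->; rewrite linform_prefix0.
  by apply: linformP; rewrite /= subrr.
move=> ->; exists (g i).2; first by rewrite im2_prefix0.
by rewrite linform_prefix0; apply: linformP; rewrite /= subrr.
Qed.

(** The disjuncts of level j+1 are first added by weakening. Each old disjunct P_j g_i = b can then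
    be removed, because resolving it with x_j = 0 or x_j = 1 gives a disjunct that is already
    there. *)
Lemma derives_prefix_valuesS H (j : 'I_n) i :
    boolean_axiom j \in H -> prefix_values j i \in H ->
  derives U (M + M * 2) H [:: prefix_values j.+1 i].
Proof.
move=> jH vH.
have sU : prefix_values j i `|` prefix_values j.+1 i `<=` U.
  by rewrite fsubUset !prefix_valuesU // ltnW.
apply: derives_trans; first exact: derives_weak vH (fsubsetUl _ _) sU.
apply: derives_elim sU _ _; first by rewrite mem_head.
have jH' : literal F j false |` [fset literal F j true] \in H by exact: jH.
move=> e C /im2_clauseP[b bP ->] sC CU.
have inC (s : bool) : P j.+1 i - cstform n (b + (g i).1 0 j *+ s) \in C.
  by apply: (fsubsetP sC); apply/im2_clauseP; exists (b + (g i).1 0 j *+ s) => //; apply: im2_prefixS.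
have -> : 2%N = (1 + 1)%N by [].
(* The clause with P_j g_i = b is used twice: its resolvent on x_j = 0 keeps the disjunct x_j = 1,
   which is then resolved against the same clause. *)
apply: derives_trans.
  apply: (@derives_res _ _ U _ C [fset literal F j true] _ (literal F j false)
            1 ((g i).1 0 j) (literal F j true |` C)); [exact: mem_head | | |].
  - by rewrite !in_cons jH' !orbT.
  - rewrite resolve_literal fsetUA fsetUC; congr (_ `|` _); apply/esym/fsetUidPr.
    by rewrite fsub1set inC.
  - by rewrite fsubUset fsub1set literalU.
apply: (@derives_res _ _ U _ C C (P j i - cstform n b) (literal F j true)
            1 ((g i).1 0 j)) => //.
- by rewrite !inE eqxx !orbT.
- exact: mem_head.
- rewrite resolve_literal fsetUid; apply/esym/fsetUidPr.
  by rewrite fsub1set inC.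
Qed.

(** All values of P_j g_i other than v_i are disjuncts of [R], so the clause of values weakens to
    P_j g_i = v_i or [R]; the literal x_j = e turns this into P_{j+1} g_i = w_i or [R]. These
    clauses, one for each i, refute the disjuncts of N_{j+1,w} one by one. *)
Lemma derives_branch H (j : 'I_n) (e : bool) v w (R : clause F n) :
    w = v + \row_i ((g i).1 0 j *+ e) -> v \in prefix_im2 j ->
    prefix_neq j v `<=` R -> R `<=` U -> literal F j e |` R \in H ->
    (forall i, prefix_values j i \in H) -> prefix_neq j.+1 w \in H ->
  derives U (m * (M + 1) + (M + M * 2)) H [:: R].
Proof.
move=> wE vP sR RU lH vH nH.
have w_im i : w 0 i \in im2 (P j.+1 i).
  by have /im2_vecP[x vx] := vP; rewrite wE vx !mxE; apply: im2_prefixS; apply/im2P; exists x.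
have w_U i : P j.+1 i - cstform n (w 0 i) \in U.
  by apply: prefixU => //; apply: im2_prefix_sub (w_im i).
pose Ys := [seq (P j.+1 i - cstform n (w 0 i)) |` R | i <- enum 'I_m].
have dY : derives U (m * (M + 1)) H Ys.
  have -> : m = size Ys by rewrite size_map size_enum_ord.
  apply: derives_all => C /mapP[i _ ->]; apply: derives_trans.
    have sU : (P j i - cstform n (v 0 i)) |` R `<=` U.
      rewrite fsubUset fsub1set RU prefixU // 1?ltnW //.
      have /im2_vecP[x ->] := vP; rewrite mxE.
      by apply/(@im2_prefix_sub _ _ j)/im2P; exists x.
    apply: derives_weak (vH i) _ sU.
    apply/fsubsetP=> h /im2_clauseP[b bP ->]; rewrite inE in_fset1.
    case: (eqVneq b (v 0 i)) => [->|bv]; first by rewrite eqxx.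
    apply/orP; right; apply: (fsubsetP sR); apply/prefix_neqP; left.
    by exists i, b.
  apply: (@derives_res _ _ U _ R R (P j i - cstform n (v 0 i)) (literal F j e)
            1 ((g i).1 0 j)).
  - exact: mem_head.
  - by rewrite inE lH orbT.
  - by rewrite resolve_literal fsetUid wE !mxE.
  - by rewrite fsubUset fsub1set w_U.
apply: derives_trans dY _.
have sU : prefix_neq j.+1 w `|` R `<=` U by rewrite fsubUset RU prefix_neqU.
apply: derives_trans.
  by apply: derives_weak _ (fsubsetUl _ R) sU; rewrite mem_cat nH orbT.
apply: derives_elim sU _ _; first exact: mem_head.
move=> h C /prefix_neqP[[i [b [bP bw ->]]]|hN] sC CU; last first.
  (* A disjunct of the goal already lies in [R], hence in [C], so nothing has to be removed. *)
  apply: derives_hyp => X; rewrite inE => /eqP->.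
  suff /fsetUidPr {1}<- : [fset h] `<=` C by apply: mem_head.
  rewrite fsub1set; apply/(fsubsetP sC)/(fsubsetP sR)/prefix_neqP; by right.
have -> : 2%N = (1 + 1)%N by [].
(* The two equations give one form two different values; their resolvent 1 = 0 is dropped by
   simplification. *)
apply: derives_trans.
  apply: (@derives_res _ _ U _ C R _ (P j.+1 i - cstform n (w 0 i))
    (w 0 i - b)^-1 (- (w 0 i - b)^-1) (cstform n 1 |` C)).
  - exact: mem_head.
  - rewrite !inE !mem_cat; apply/orP; right; apply/orP; right; apply/orP; left.
    by apply/mapP; exists i => //; rewrite mem_enum.
  - by rewrite resolve_values // (fsetUidPl _ _ sC).
  - by rewrite fsubUset fsub1set oneU.
apply: derives_step => //; apply: (@Simplification _ _ _ _ 1); first exact: oner_neq0.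
exact: mem_head.
Qed.

(** Case distinction on x_j: from the boolean axiom weakened by N_{j,v}, the literal x_j = 0 is
    removed while x_j = 1 still belongs to [R]; then x_j = 1 is removed. *)
Lemma derives_prefix_neq H (j : 'I_n) v :
    v \in prefix_im2 j -> boolean_axiom j \in H ->
    (forall i, prefix_values j i \in H) ->
    (forall w, w \in prefix_im2 j.+1 -> prefix_neq j.+1 w \in H) ->
  derives U (M + ((m * (M + 1) + (M + M * 2)) + (m * (M + 1) + (M + M * 2)))) H
    [:: prefix_neq j v].
Proof.
move=> vP jH vH nH.
have w_im (e : bool) : v + \row_i ((g i).1 0 j *+ e) \in prefix_im2 j.+1.
  have /im2_vecP[x ->] := vP; apply/im2_vecP; exists (set_bit x j e).
  by apply/rowP=> i; rewrite !mxE lineval_prefixS.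
have NU : prefix_neq j v `<=` U by rewrite prefix_neqU // ltnW.
have l1U : literal F j true |` prefix_neq j v `<=` U by rewrite fsubUset fsub1set literalU.
have l01U : literal F j false |` (literal F j true |` prefix_neq j v) `<=` U.
  by rewrite fsubUset fsub1set literalU.
apply: derives_trans.
  by apply: derives_weak jH _ l01U; rewrite fsetUA fsubsetUl.
apply: derives_trans.
  apply: (derives_branch (erefl _) vP _ l1U); first exact: fsubsetUr.
  - exact: mem_head.
  - by move=> i; rewrite inE vH orbT.
  - by rewrite inE nH ?orbT.
apply: (derives_branch (erefl _) vP (fsubset_refl _) NU).
- exact: mem_head.
- by move=> i; rewrite !inE vH !orbT.
- by rewrite !inE nH ?orbT.
Qed.

(** The whole system takes the values of level [k] at points that vanish from index [k] on. So no
    level needs more clauses than the system has values. *)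
Lemma prefix_im2_card k : (#|` prefix_im2 k| <= #|` im2_vec g|)%N.
Proof.
apply: fsubset_leq_card; apply/fsubsetP=> v /im2_vecP[x ->].
apply/im2_vecP; exists (bit_prefix k x).
by apply/rowP=> i; rewrite !mxE lineval_prefix.
Qed.

Definition boolean_axioms : seq (clause F n) := [seq boolean_axiom j | j <- enum 'I_n].

Definition all_prefix_values : seq (clause F n) :=
  [seq prefix_values k i | k <- iota 0 n.+1, i <- enum 'I_m].

Definition all_prefix_neq k : seq (clause F n) :=
  [seq prefix_neq k v | v <- enum_fset (prefix_im2 k)].

Lemma mem_boolean_axioms j : boolean_axiom j \in boolean_axioms.
Proof. by apply: map_f; rewrite mem_enum. Qed.

Lemma mem_all_prefix_values k i : (k <= n)%N -> prefix_values k i \in all_prefix_values.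
Proof. by move=> kn; apply: allpairs_f; rewrite ?mem_iota ?mem_enum. Qed.

Lemma derives_prefix_values H k i : (k <= n)%N ->
    {subset boolean_axioms <= H} -> [fset cstform n 0] \in H ->
  derives U (k * (M + M * 2)) H [:: prefix_values k i].
Proof.
move=> kn axH zH; elim: k kn => [|k IH] kn.
  by apply: derives_hyp => X; rewrite inE prefix_values0 => /eqP->.
rewrite mulSn addnC; apply: derives_trans (IH (ltnW kn)) _.
apply: (@derives_prefix_valuesS _ (Ordinal kn)); last exact: mem_head.
by rewrite inE axH ?orbT ?mem_boolean_axioms.
Qed.

(** The clause 0 = 0, from which the clauses of values start, is derived from a boolean axiom, hence
    from a variable. Each of the (n+1)m clauses is rederived from it separately, at the price of a
    factor n. *)
Lemma derives_base : (0 < n)%N ->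
  derives U (n + (2 + n.+1 * m * (n * (M + M * 2)))) [::]
    (boolean_axioms ++ all_prefix_values).
Proof.
move=> n0; apply: derives_cut.
  apply: (@derives_leq _ _ _ (size boolean_axioms * 1)).
    by rewrite muln1 size_map size_enum_ord.
  by apply: derives_all => C /mapP[j _ ->]; exact: derives_boolean_axiom.
apply: derives_trans.
  apply: (@derives_zero _ (Ordinal n0)).
  by rewrite mem_cat mem_boolean_axioms.
apply: (@derives_leq _ _ _ (size all_prefix_values * (n * (M + M * 2)))).
  by rewrite size_allpairs size_iota size_enum_ord.
apply: derives_all => C /allpairsP[[k i] []].
rewrite mem_iota add0n ltnS /= => kn _ ->.
apply: derives_leq (derives_prefix_values _ kn _ _).
- by rewrite leq_mul2r kn orbT.
- by move=> X XA; rewrite inE mem_cat XA !orbT.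
- exact: mem_head.
Qed.

(** Some coordinate v_i of a value [v] is nonzero. The only disjunct of the clause of values of g_i
    that <g_i <> v_i> lacks is g_i = v_i, and this one lies in the goal. *)
Lemma derives_last_level H : no01_solution g ->
    (forall i, prefix_values n i \in H) ->
  derives U (#|` im2_vec g| * M) H (all_prefix_neq n).
Proof.
move=> g0 vH; apply: (@derives_leq _ _ _ (size (all_prefix_neq n) * M)).
  by rewrite leq_mul2r size_map prefix_im2_card orbT.
apply: derives_all => C /mapP[v /im2_vecP[x vx] ->].
have [i vi] : exists i, v 0 i != 0.
  apply/existsP; apply: contra_notT g0; rewrite negb_exists => /forallP v0.
  exists x => i; have /eqP := negbNE (v0 i).
  by rewrite vx mxE linform_prefix_full.
apply: derives_weak (vH i) _ _; last exact: prefix_neqU.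
apply/fsubsetP=> h /im2_clauseP[b bP ->]; apply/prefix_neqP.
have [bv|bv] := eqVneq b (v 0 i); last by left; exists i, b.
right; apply/neq0_clauseP; exists i; apply/neq_clauseP; exists b.
rewrite bv vi; split=> //; by move: bP; rewrite linform_prefix_full bv.
Qed.

Let level_cost := M + ((m * (M + 1) + (M + M * 2)) + (m * (M + 1) + (M + M * 2))).

Lemma derives_level k d H : (k + d = n)%N ->
    {subset boolean_axioms <= H} -> {subset all_prefix_values <= H} ->
    {subset all_prefix_neq n <= H} ->
  derives U (d * (#|` im2_vec g| * level_cost)) H (all_prefix_neq k).
Proof.
move=> kd aH vH nH; elim: d k kd => [|d IH] k kd.
  by apply: derives_hyp; rewrite -(addn0 k) kd.
rewrite mulSn addnC; apply: derives_trans (IH k.+1 _) _; first by rewrite addSnnS.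
have kn : (k < n)%N by lia.
apply: (@derives_leq _ _ _ (size (all_prefix_neq k) * level_cost)).
  by rewrite leq_mul2r size_map prefix_im2_card orbT.
apply: derives_all => C /mapP[v vP ->].
apply: (@derives_prefix_neq _ (Ordinal kn)) => //.
- by rewrite mem_cat aH ?orbT ?mem_boolean_axioms.
- by move=> i; rewrite mem_cat vH ?orbT // mem_all_prefix_values // ltnW.
- by move=> w wP; rewrite mem_cat map_f.
Qed.

(** The target is any [D] above the goal of [g]: [g] is going to be a subsystem, and a last
    weakening reaches the clause of the larger system. *)
Lemma derives_neq0_clause (D : clause F n) : (0 < n)%N -> no01_solution g ->
    neq0_clause g `<=` D -> D `<=` U ->
  derives U (n + (2 + n.+1 * m * (n * (M + M * 2))) +
    (#|` im2_vec g| * M + (n * (#|` im2_vec g| * level_cost) + M))) [::] [:: D].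
Proof.
move=> n0 g0 sD DU; apply: derives_trans (derives_base n0) _.
rewrite cats0; apply: derives_trans.
  apply: derives_last_level => // i.
  by rewrite mem_cat mem_all_prefix_values ?orbT.
apply: derives_trans.
  apply: (@derives_level 0 n) => //.
  - by move=> X XA; rewrite mem_cat (mem_cat X boolean_axioms) XA !orbT.
  - by move=> X XA; rewrite mem_cat (mem_cat X boolean_axioms) XA !orbT.
  - by move=> X XA; rewrite !mem_cat XA.
apply: (@derives_weak _ _ _ _ (neq0_clause g)) => //.
rewrite mem_cat; apply/orP; left.
pose v : 'rV[F]_m := \row_i lineval (P 0 i) [ffun=> false].
have vP : v \in prefix_im2 0 by apply/im2_vecP; exists [ffun=> false].
by rewrite -(prefix_neq0 vP); apply: map_f.
Qed.

End Refutation.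

(** * Rank bounds for the values of a system and for the disjuncts of its goal *)

Section Cardinality.

Import GRing.Theory.
Local Open Scope fset_scope.
Local Open Scope ring_scope.

Variables (F : fieldType) (n m : nat) (f : 'I_m -> linform F n).

Lemma leq_card_imfset (T : finType) (K : choiceType) (e : T -> K) (X : {fset K}) :
  {subset X <= [seq e t | t : T]} -> (#|` X| <= #|T|)%N.
Proof.
move=> sX; rewrite -(size_image e T); apply: uniq_leq_size => //; exact: fset_uniq.
Qed.

Lemma leq_card_inj (T : finType) (K : choiceType) (e : T -> K) (X : {fset K}) :
  injective e -> (forall t, e t \in X) -> (#|T| <= #|` X|)%N.
Proof.
move=> eI eX; rewrite -(size_image e T); apply: uniq_leq_size.
  by rewrite map_inj_uniq ?enum_uniq.
by move=> x /imageP[t _ ->].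
Qed.

(** Rows belong to variables and columns to equations, so assignments act as row vectors from the
    left. *)
Let A : 'M[F]_(n, m) := \matrix_(j, i) (f i).1 0 j.

(** Choose as many variables as the rank, with independent rows, and set the others to 0. Distinct
    0-1 assignments to the chosen ones give distinct combinations of independent rows, hence
    distinct values. *)
Lemma im2_vec_card_rank : (2 ^ \rank A <= #|` im2_vec f|)%N.
Proof.
have mfI := @maxrankfun_inj _ _ _ A.
set mf := maxrankfun A in mfI.
have Rfree : row_free (rowsub mf A) := maxrowsub_free A.
pose x (S : {ffun 'I_(\rank A) -> bool}) : {ffun 'I_n -> bool} :=
  [ffun j => if [pick k | mf k == j] is Some k then S k else false].
have xE S k : x S (mf k) = S k.
  rewrite ffunE; case: pickP => [k' /eqP/mfI->//|/(_ k)].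
  by rewrite eqxx.
pose e S : 'rV[F]_m := \row_i lineval (f i) (x S).
have eE S : e S = (\row_k (S k)%:R) *m rowsub mf A + \row_i (f i).2.
  apply/rowP=> i; rewrite !mxE /lineval; congr (_ + _).
  rewrite (bigID (mem (codom mf))) /= [X in _ + X]big1 ?addr0; last first.
    move=> j jN; rewrite ffunE; case: pickP => [k /eqP kj|_]; last by rewrite mulr0.
    by rewrite -kj codom_f in jN.
  rewrite (eq_bigl (fun j => j \in codom mf)) //.
  rewrite -big_uniq /=; last by rewrite map_inj_uniq ?enum_uniq.
  rewrite /codom /image_mem big_map big_enum /=; apply: eq_bigr => k _.
  by rewrite xE !mxE mulrC.
rewrite -[in X in (X <= _)%N](card_ord (\rank A)) -card_bool -card_ffun.
apply: (@leq_card_inj _ _ e) => [S S'|S]; last by apply/im2_vecP; exists (x S).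
rewrite !eE => /addIr /(row_free_inj Rfree) /rowP SS.
apply/ffunP=> k; have := SS k; rewrite !mxE.
by case: (S k) (S' k) => [] [] //= /eqP; rewrite ?oner_eq0 // eq_sym oner_eq0.
Qed.

(** All rows of [A] are combinations, with coefficients [W], of the chosen independent rows. So a
    disjunct is determined by its coefficients at the chosen variables and its constant term. *)
Lemma neq0_clause_card_rank (s : seq F) : uniq s -> (forall a, a \in s) ->
  (#|` neq0_clause f| <= size s ^ \rank A * size s)%N.
Proof.
move=> s_uniq sF; set mf := maxrankfun A.
have sR : (A <= rowsub mf A)%MS by rewrite eq_maxrowsub.
pose W := A *m pinvmx (rowsub mf A).
have AE : A = W *m rowsub mf A by rewrite mulmxKpV.
pose e (t : {ffun 'I_(\rank A) -> seq_sub s} * seq_sub s) : linform F n :=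
  (\row_j \sum_k W j k * val (t.1 k), val t.2).
apply: (@leq_trans #|{: {ffun 'I_(\rank A) -> seq_sub s} * seq_sub s}|); last first.
  by rewrite card_prod card_ffun card_ord card_seq_sub.
apply: (@leq_card_imfset _ _ e) => h /neq0_clauseP[i /neq_clauseP[b [_ _ ->]]].
apply/imageP.
exists ([ffun k => SeqSub (sF (A (mf k) i))], SeqSub (sF ((f i).2 - b))) => //.
apply: linformP => //=; apply/rowP=> j; rewrite subr0 !mxE.
transitivity (A j i); first by rewrite mxE.
rewrite {1}AE mxE; apply: eq_bigr => k _; rewrite ffunE /=.
by rewrite [rowsub _ _ _ _]mxE.
Qed.

Lemma neq0_clause_card (s : seq F) : uniq s -> (forall a, a \in s) ->
  (#|` neq0_clause f| <= #|` im2_vec f| ^ size s * size s)%N.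
Proof.
move=> s_uniq sF; apply: leq_trans (neq0_clause_card_rank s_uniq sF) _.
rewrite leq_mul2r; apply/orP; right.
(* With q = [size s] and r the rank, q <= 2^q gives q^r <= (2^r)^q, and 2^r is at most the number of
   values. *)
apply: (@leq_trans ((2 ^ size s) ^ \rank A)).
  have [->|r0] := posnP (\rank A); first by rewrite !expn0.
  by rewrite leq_exp2r // ltnW // ltn_expl.
rewrite -expnM mulnC expnM.
have [->|s0] := posnP (size s); first by rewrite !expn0.
by rewrite leq_exp2r // im2_vec_card_rank.
Qed.

End Cardinality.

(** * Sizes of the forms in the derivation *)

Section Size.

Import GRing.Theory.
Local Open Scope fset_scope.
Local Open Scope ring_scope.

Variables (F : fieldType) (csize : F -> nat) (n : nat).

Lemma clause_size_leq (C : clause F n) B :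
    (forall h, h \in C -> linform_size csize h <= B)%N ->
  (clause_size csize C <= #|` C| * B)%N.
Proof.
move=> sB; rewrite /clause_size -sum1_size big_distrl /= !big_seq.
by apply: leq_sum => h hC; rewrite mul1n sB.
Qed.

Lemma linform_size_clause (C : clause F n) h :
  h \in C -> (linform_size csize h <= clause_size csize C)%N.
Proof.
by move=> hC; rewrite /clause_size (big_fsetD1 h) //= leq_addr.
Qed.

Lemma linform_size_system m (f : 'I_m -> linform F n) i :
  (linform_size csize (f i) <= system_size csize f)%N.
Proof. by rewrite /system_size (bigD1 i) //= leq_addr. Qed.

Lemma linform_size_vars k (f : linform F n) b :
  (linform_size csize (linform_prefix k f - cstform n b)%R
   <= linform_size csize f + csize (f.2 - b)%R)%N.
Proof.
rewrite /linform_size /= subr0 -addnA leq_add //; last by rewrite leq_addl.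
rewrite [X in (X <= _)%N]big_mkcond [X in (_ <= X)%N]big_mkcond /=.
by apply: leq_sum => i _; rewrite mxE; case: (i < k)%N; rewrite ?eqxx.
Qed.

(** [csize] is arbitrary, so the new constant term must already occur in the input or the goal: for
    nonzero [b] it is that of the goal disjunct f_i = b, for b = 0 that of f_i itself. *)
Lemma linform_size_prefix m (f : 'I_m -> linform F n) k i b : b \in im2 (f i) ->
  (linform_size csize (linform_prefix k (f i) - cstform n b)%R
   <= 2 * system_size csize f + clause_size csize (neq0_clause f))%N.
Proof.
move=> bf; apply: leq_trans (linform_size_vars _ _ _) _.
have cS (h : linform F n) : (csize h.2 <= linform_size csize h)%N by apply: leq_addl.
have fS := linform_size_system f i.
have [->|b0] := eqVneq b 0.
  rewrite subr0 mul2n -addnn; apply: leq_trans (leq_addr _ _).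
  by apply: leq_add fS (leq_trans (cS _) fS).
have fbC : f i - cstform n b \in neq0_clause f.
  by apply/neq0_clauseP; exists i; apply/neq_clauseP; exists b.
have bS := leq_trans (cS _) (linform_size_clause fbC); rewrite /= in bS.
by apply: leq_add bS; rewrite mul2n -addnn (leq_trans fS) ?leq_addr.
Qed.

Lemma linform_size_literal j e : (linform_size csize (literal F j e : linform F n)
  <= 1 + csize 1%R + csize 0%R + csize (-1)%R)%N.
Proof.
rewrite /linform_size /= (bigD1 j) ?mxE ?eqxx ?subr0 ?oner_eq0 //= big1.
  by case: e; rewrite sub0r ?oppr0 ?addn0 ?leq_addr // leq_add // leq_addr.
by move=> i /andP[ci /negPf ij]; move: ci; rewrite mxE ij andbF eqxx.
Qed.

Lemma linform_size_cst c : linform_size csize (cstform n c) = csize c.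
Proof. by rewrite /linform_size big1 // => i; rewrite mxE eqxx. Qed.

(** [csize] may vanish, but every variable occurrence counts 1. A disjunct without variables is a
    constant form minus its only value, hence the zero form; this one exception accounts for the
    successor. *)
Lemma neq0_clause_card_size m (f : 'I_m -> linform F n) :
  (#|` neq0_clause f| <= (clause_size csize (neq0_clause f)).+1)%N.
Proof.
set C := neq0_clause f; pose z : linform F n := 0.
have vars_gt0 h : h \in C `\ z -> (1 <= linform_size csize h)%N.
  rewrite !inE => /andP[h0 /neq0_clauseP[i /neq_clauseP[b [/im2P[x bx] _ hE]]]].
  case: (pickP (fun j => h.1 0 j != 0)) => [j hj|h1].
    by rewrite /linform_size (bigD1 j) //= -!addnA.
  have fi0 j : (f i).1 0 j = 0.
    by have /eqP := negbFE (h1 j); rewrite hE /= subr0.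
  case/eqP: h0; rewrite hE; apply: linformP => /=.
    by apply/rowP=> j; rewrite subr0 fi0 mxE.
  rewrite bx /lineval big1 ?add0r ?subrr // => j _; by rewrite fi0 mul0r.
have le1 : (#|` C| <= #|` C `\ z|.+1)%N.
  by rewrite (cardfsD1 z C); case: (_ \in _) => //; rewrite add0n.
apply: leq_trans le1 _; rewrite ltnS.
apply: leq_trans (clause_size_sub csize (fsubD1set C z)).
rewrite /clause_size -sum1_size !big_seq; exact: leq_sum.
Qed.

End Size.

(** * Choice of the universe and the total bound *)

Section Assembly.

Import GRing.Theory.
Local Open Scope fset_scope.
Local Open Scope ring_scope.

Variables (F : fieldType) (csize : F -> nat) (n : nat).

(* One equation violated by each value of the system is enough to keep it
   unsatisfiable. *)
Lemma unsat_subsystem m (f : 'I_m -> linform F n) : no01_solution f ->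
  exists h : 'I_#|` im2_vec f| -> 'I_m, no01_solution (fun t => f (h t)).
Proof.
move=> f0; pose vs := enum_fset (im2_vec f).
have H (t : 'I_#|` im2_vec f|) : exists i, nth 0 vs t 0 i != 0.
  have /im2_vecP[x vx] : nth 0 vs t \in im2_vec f by apply: mem_nth.
  apply/existsP; apply: contra_notT f0; rewrite negb_exists => /forallP v0.
  by exists x => i; have /eqP := negbNE (v0 i); rewrite vx mxE.
have [h hP] := fin_all_exists H; exists h => -[x xh].
pose v : 'rV[F]_m := \row_i lineval (f i) x.
have vP : v \in im2_vec f by apply/im2_vecP; exists x.
have lt : (index v vs < #|` im2_vec f|)%N by rewrite index_mem.
by have := hP (Ordinal lt); rewrite nth_index // mxE xh eqxx.
Qed.

Lemma im2_vec_comp_card m m' (f : 'I_m -> linform F n) (h : 'I_m' -> 'I_m) :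
  (#|` im2_vec (fun t => f (h t))| <= #|` im2_vec f|)%N.
Proof.
have -> : im2_vec (fun t => f (h t)) =
    [fset (\row_t (v : 'rV[F]_m) 0 (h t) : 'rV[F]_m') | v in im2_vec f].
  apply/fsetP=> w; apply/im2_vecP/imfsetP => [[x ->]|[v /im2_vecP[x ->] ->]].
    exists (\row_i lineval (f i) x); first by apply/im2_vecP; exists x.
    by apply/rowP=> t; rewrite !mxE.
  by exists x; apply/rowP=> t; rewrite !mxE.
exact: leq_imfset_card.
Qed.

(** Value vectors rather than single values serve as parameters, since the values of g_i are the
    i-th coordinates of such vectors; counting parameters then involves the number of values of the
    system. *)
Definition prefix_value m (g : 'I_m -> linform F n)
    (t : 'I_n.+1 * 'I_m * im2_vec g) : linform F n :=
  linform_prefix t.1.1 (g t.1.2) - cstform n (val t.2 0 t.1.2).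

Definition universe m (g : 'I_m -> linform F n) (D : clause F n) : clause F n :=
  D `|` ([fset cstform n 0; cstform n 1] `|`
   ([fset literal F t.1 t.2 | t in {: 'I_n * bool}] `|`
    [fset prefix_value t | t in {: 'I_n.+1 * 'I_m * im2_vec g}])).

Lemma universe_card m (g : 'I_m -> linform F n) D :
  (#|` universe g D| <= #|` D| + (2 + (n * 2 + n.+1 * m * #|` im2_vec g|)))%N.
Proof.
apply: leq_trans (leq_card_fsetU _ _) _; rewrite leq_add2l.
apply: leq_trans (leq_card_fsetU _ _) (leq_add _ _).
  by rewrite cardfs2; case: eqP.
apply: leq_trans (leq_card_fsetU _ _) (leq_add _ _).
  apply: leq_trans (leq_imfset_card _ _ _) _.
  by rewrite -cardE card_prod card_ord card_bool.
apply: leq_trans (leq_imfset_card _ _ _) _.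
by rewrite -cardE !card_prod !card_ord -cardfE.
Qed.

Definition step_cost n m N M : nat :=
  (n + (2 + n.+1 * m * (n * (M + M * 2))) +
    (N * M + (n * (N * (M + ((m * (M + 1) + (M + M * 2)) +
                             (m * (M + 1) + (M + M * 2))))) + M)))%N.

Definition line_cost n N K : nat := (K + (2 + (n * 2 + n.+1 * N * N)))%N.

(** Lines, times forms in the universe, times the size [B] of a form; [K] counts the disjuncts of
    the goal. [N] also stands for the number of equations, as the subsystem has one equation per
    value. *)
Definition total_cost n N K B : nat :=
  (step_cost n N N (line_cost n N K) * (line_cost n N K * B))%N.

Lemma step_cost_leq n1 n2 m1 m2 N1 N2 M1 M2 :
    (n1 <= n2)%N -> (m1 <= m2)%N -> (N1 <= N2)%N -> (M1 <= M2)%N ->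
  (step_cost n1 m1 N1 M1 <= step_cost n2 m2 N2 M2)%N.
Proof. by move=> *; rewrite /step_cost; repeat (apply: leq_add || apply: leq_mul). Qed.

Lemma line_cost_leq n1 n2 N1 N2 K1 K2 :
    (n1 <= n2)%N -> (N1 <= N2)%N -> (K1 <= K2)%N ->
  (line_cost n1 N1 K1 <= line_cost n2 N2 K2)%N.
Proof. by move=> *; rewrite /line_cost; repeat (apply: leq_add || apply: leq_mul). Qed.

Lemma total_cost_leq n1 n2 N1 N2 K1 K2 B1 B2 :
    (n1 <= n2)%N -> (N1 <= N2)%N -> (K1 <= K2)%N -> (B1 <= B2)%N ->
  (total_cost n1 N1 K1 B1 <= total_cost n2 N2 K2 B2)%N.
Proof.
move=> nn NN KK BB; have LL := line_cost_leq nn NN KK.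
by apply: leq_mul; rewrite ?step_cost_leq // leq_mul.
Qed.

(** Running the derivation on the subsystem [g] removes [m] from the bound. The size [B] of a form
    is a parameter because it is bounded differently over arbitrary and over finite fields. *)
Lemma reslin_derivation_bound m (f : 'I_m -> linform F n) B :
    (0 < n)%N -> no01_solution f ->
    (forall k i b, b \in im2 (f i) ->
       (linform_size csize (linform_prefix k (f i) - cstform n b)%R <= B)%N) ->
    (1 + csize 1%R + csize 0%R + csize (-1)%R <= B)%N ->
  exists pi, reslin_derivation pi (neq0_clause f) /\
    (derivation_size csize pi <=
     total_cost n #|` im2_vec f| #|` neq0_clause f| B)%N.
Proof.
move=> n0 f0 fB cB; have [h h0] := unsat_subsystem f0.
set g := (fun t => f (h t)) in h0.
have gN := im2_vec_comp_card f h; rewrite -/g in gN.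
pose U := universe g (neq0_clause f).
have sgf : neq0_clause g `<=` neq0_clause f.
  by apply/fsubsetP=> e /neq0_clauseP[t et]; apply/neq0_clauseP; exists (h t).
have UB e : e \in U -> (linform_size csize e <= B)%N.
  rewrite !inE => /or4P[/neq0_clauseP[i /neq_clauseP[b [bi _ ->]]]| /orP[]/eqP->
    | /imfsetP[t _ ->] | /imfsetP[t _ ->]].
  - by rewrite -[X in (X - _)%R]linform_prefix_full fB.
  - by rewrite linform_size_cst; apply: leq_trans cB; rewrite -addnA addnC -!addnA leq_addr.
  - by rewrite linform_size_cst; apply: leq_trans cB; rewrite -!addnA addnCA leq_addr.
  - exact: leq_trans (linform_size_literal _ _ _) cB.
  - rewrite /prefix_value; apply: fB; have /im2_vecP[x ->] := valP t.2.
    by rewrite mxE; apply/im2P; exists x.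
have card_U : (#|` U| <= line_cost n #|` im2_vec f| #|` neq0_clause f|)%N.
  apply: leq_trans (universe_card _ _) _.
  by rewrite leq_add2l !leq_add2l leq_mul.
have [||||pi [pi_ok pi_size]] := derives_derivation csize
   (@derives_neq0_clause F n _ g U _ _ _ _ (neq0_clause f) n0 h0 sgf (fsubsetUl _ _)).
- move=> k i b kn /im2P[x bx]; rewrite !inE; apply/or4P; constructor 4.
  have vP : \row_i lineval (g i) x \in im2_vec g by apply/im2_vecP; exists x.
  apply/imfsetP; exists ((Ordinal (kn : (k < n.+1)%N), i), FSetSub vP) => //.
  by rewrite /prefix_value /= mxE bx.
- move=> j e; rewrite !inE; apply/or4P; constructor 3.
  by apply/imfsetP; exists (j, e).
- by rewrite !inE eqxx !orbT.
- by rewrite !inE eqxx !orbT.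
exists pi; split=> //; apply: leq_trans pi_size _.
apply: leq_mul; first exact: step_cost_leq.
apply: leq_trans (clause_size_leq UB) _.
by rewrite leq_mul2r card_U orbT.
Qed.

End Assembly.

(** * Closure properties of polynomial bounds *)

Section PolynomialFunctions.

Local Open Scope nat_scope.

Definition polynomial_fun (c : nat -> nat) : Prop :=
  exists p : {poly nat}, forall z, horner p z = c z.

Lemma polynomial_fun_cst a : polynomial_fun (fun _ => a).
Proof. by exists (polyC a) => z; rewrite hornerC. Qed.

Lemma polynomial_fun_id : polynomial_fun id.
Proof. by exists (polyX _) => z; rewrite hornerX. Qed.

Lemma polynomial_funD c d :
  polynomial_fun c -> polynomial_fun d -> polynomial_fun (fun z => c z + d z).
Proof. by move=> [p pE] [q qE]; exists (p + q)%R => z; rewrite hornerD pE qE. Qed.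

Lemma polynomial_funM c d :
  polynomial_fun c -> polynomial_fun d -> polynomial_fun (fun z => c z * d z).
Proof. by move=> [p pE] [q qE]; exists (p * q)%R => z; rewrite hornerM pE qE. Qed.

Lemma polynomial_funX c e :
  polynomial_fun c -> polynomial_fun (fun z => c z ^ e).
Proof.
move=> cP; elim: e => [|e IH]; first exact: polynomial_fun_cst.
have [p pE] := polynomial_funM cP IH; exists p => z; by rewrite pE expnS.
Qed.

Lemma polynomial_fun_total_cost cn cN cK cB :
    polynomial_fun cn -> polynomial_fun cN -> polynomial_fun cK -> polynomial_fun cB ->
  polynomial_fun (fun z => total_cost (cn z) (cN z) (cK z) (cB z)).
Proof.
move=> Pn PN PK PB; rewrite /total_cost /step_cost /line_cost.
have PS : polynomial_fun (fun z => (cn z).+1).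
  by have [p pE] := polynomial_funD (polynomial_fun_cst 1) Pn; exists p.
repeat (assumption || apply: polynomial_fun_cst || apply: polynomial_funD || apply: polynomial_funM).
Qed.

End PolynomialFunctions.

(** * Bounds over an arbitrary field and over a finite field *)

Theorem mainTheorem12 (F : fieldType) (csize : F -> nat) :
  (exists p : {poly nat},
     forall (n m : nat) (f : 'I_m -> linform F n),
       0 < n -> no01_solution f ->
       exists pi : seq (clause F n),
         reslin_derivation pi (neq0_clause f) /\
         derivation_size csize pi <=
           horner p (n + #|` im2_vec f| +
                     (system_size csize f + clause_size csize (neq0_clause f))))
  /\
  ((exists s : seq F, forall a : F, a \in s) ->
   exists p : {poly nat},
     forall (n m : nat) (f : 'I_m -> linform F n),
       0 < n -> no01_solution f ->
       exists pi : seq (clause F n),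
         reslin_derivation pi (neq0_clause f) /\
         derivation_size csize pi <= horner p (n + #|` im2_vec f|)).

Proof.
set K := 1 + csize 1%R + csize 0%R + csize (-1)%R; split.
  (* The goal has at most one disjunct more than its size, hence [S]. Forms have size at most 2s + c
     + K, where the sizes s of the input and c of the goal add up to at most the argument. *)
  have [||||p pE] := @polynomial_fun_total_cost id id S (fun z => 2 * z + K).
  - exact: polynomial_fun_id.
  - exact: polynomial_fun_id.
  - exact: polynomial_funD (polynomial_fun_cst 1) polynomial_fun_id.
  - apply: polynomial_funD (polynomial_fun_cst K).
    exact: polynomial_funM (polynomial_fun_cst 2) polynomial_fun_id.
  exists p => n m f n0 f0; rewrite pE.
  set s := system_size csize f; set c := clause_size csize _.
  have [||pi [pi_ok pi_size]] :=
    @reslin_derivation_bound F csize n m f (2 * s + c + K) n0 f0.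
  - move=> k i b bf; apply: leq_trans (linform_size_prefix _ _ bf) _.
    exact: leq_addr.
  - exact: leq_addl.
  exists pi; split=> //; apply: leq_trans pi_size _.
  have := neq0_clause_card_size csize f; rewrite -/c => cC.
  by apply: total_cost_leq; lia.
case=> s0 s0F; pose s := undup s0.
have s_uniq : uniq s by apply: undup_uniq.
have sF a : a \in s by rewrite mem_undup.
(* Over a finite field encodings have bounded size, so a form has size linear in n. *)
pose Q := \max_(a <- s) csize a.
have csQ a : csize a <= Q by apply: leq_bigmax_seq.
(* The third function bounds the number of disjuncts; it is a polynomial because the exponent
   [size s] depends on the field only. *)
have [||||p pE] := @polynomial_fun_total_cost id id
  (fun z => z ^ size s * size s) (fun z => z * (1 + Q) + Q + Q + K).
- exact: polynomial_fun_id.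
- exact: polynomial_fun_id.
- apply: polynomial_funM (polynomial_fun_cst _).
  exact: polynomial_funX polynomial_fun_id.
- do 3!apply: polynomial_funD (polynomial_fun_cst _).
  exact: polynomial_funM polynomial_fun_id (polynomial_fun_cst _).
exists p => n m f n0 f0; rewrite pE.
have linB (h : linform F n) : linform_size csize h <= n * (1 + Q) + Q.
  apply: leq_add => //; rewrite big_mkcond /=.
  rewrite -[n in n * _]card_ord -sum_nat_const; apply: leq_sum => i _.
  by case: ifP => // _; rewrite leq_add2l.
have [||pi [pi_ok pi_size]] :=
  @reslin_derivation_bound F csize n m f (n * (1 + Q) + Q + Q + K) n0 f0.
- by move=> k i b _; apply: leq_trans (linB _) _; rewrite -!addnA !leq_add2l leq_addr.
- exact: leq_addl.
exists pi; split=> //; apply: leq_trans pi_size _.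
apply: total_cost_leq; rewrite ?leq_addr ?leq_addl //.
  apply: leq_trans (neq0_clause_card f s_uniq sF) _.
  rewrite leq_mul2r; apply/orP; right.
  have [->|] := posnP (size s); first by rewrite !expn0.
  by move=> s0'; rewrite leq_exp2r // leq_addl.
by rewrite !leq_add2r leq_mul2r leq_addr orbT.
Qed.
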